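(* Let $0 \to A \to L \xrightarrow{p} B \to 0$ be an abelian extension of Lie algebras over a field $F$, let $s: B \to L$ be an $F$-linear section of $p$ with associated map $\mu$, let $\alpha: B \to \mathrm{End}(A)$ be the induced $B$-module structure on $A$, and let $(\theta, \phi) \in \mathrm{Aut}(A)\times \mathrm{Aut}(B)$. Then the pair $(\theta, \phi)$ is inducible if and only if the following two conditions hold: (1) There exists an $F$-linear map $\lambda: B \to A$ such that $$\theta\big(\mu(b_1, b_2)\big)-\mu\big(\phi(b_1),\phi(b_2)\big)=\phi(b_1)\lambda(b_2)-\phi(b_2)\lambda(b_1)-\lambda\big([b_1,b_2]\big)\quad\text{for all } b_1,b_2 \in B.$$ (2) $\alpha(\phi(b)) =\theta\, \alpha(b)\, \theta^{-1}$ for all $b \in B$.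
   Context: All Lie algebras are over a field $F$ (not assumed finite dimensional). An extension of $B$ by $A$ is a short exact sequence of Lie algebras $0 \to A \to L \xrightarrow{p} B \to 0$; it is called abelian if $A$ is an abelian Lie algebra. We regard $A$ as an ideal of $L$ via the inclusion. A section is an $F$-linear map $s: B\to L$ with $p s = 1_B$. For an abelian extension, $A$ is a left $B$-module via $ba = [s(b),a]$ for $b\in B$, $a \in A$ (independent of the choice of $s$); the corresponding Lie algebra homomorphism is denoted $\alpha: B \to \mathrm{End}(A)$, where $\mathrm{End}(A)$ is the Lie algebra of all $F$-linear endomorphisms of $A$ with bracket $[f,g]=fg-gf$. The map associated to $s$ is $\mu: B\times B \to A$, $\mu(b_1,b_2)=[s(b_1),s(b_2)]-s([b_1,b_2])$. $\mathrm{Aut}(\cdot)$ denotes the group of Lie algebra automorphisms. $\mathrm{Aut}_A(L)$ is the group of Lie algebra automorphisms $\gamma$ of $L$ with $\gamma(A)=A$. Define $\tau: \mathrm{Aut}_A(L) \to \mathrm{Aut}(A)\times \mathrm{Aut}(B)$ by $\tau(\gamma) = (\gamma|_A, \overline{\gamma})$, where $\overline{\gamma}(b) = p(\gamma(s(b)))$. A pair $(\theta,\phi) \in \mathrm{Aut}(A)\times\mathrm{Aut}(B)$ is called inducible if there is $\gamma \in \mathrm{Aut}_A(L)$ with $\tau(\gamma) = (\theta,\phi)$. *)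

(* Defs.v *)
From HB Require Import structures.
From mathcomp Require Import all_boot all_algebra.
From mathcomp Require Import boolp classical_sets.

Set Implicit Arguments.
Unset Strict Implicit.
Unset Printing Implicit Defensive.

Import GRing.Theory.
Local Open Scope classical_set_scope.
Local Open Scope ring_scope.

HB.mixin Record isLieAlgebra (F : fieldType) L of GRing.Lmodule F L := {
  lie : L -> L -> L;
  lie_linear_l : forall y : L, linear (lie^~ y);
  lie_linear_r : forall x : L, linear (lie x);
  liexx : forall x : L, lie x x = 0;
  lie_jacobi : forall x y z : L,
    lie x (lie y z) + lie y (lie z x) + lie z (lie x y) = 0
}.

#[short(type="lieAlgType")]
HB.structure Definition LieAlgebra (F : fieldType) :=
  {L of isLieAlgebra F L & GRing.Lmodule F L}.

Notation "[ 'lie' x , y ]" := (lie x y)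
  (at level 0, x, y at level 99, format "[ 'lie'  x ,  y ]") : ring_scope.

Section LieTheory.
Variables (F : fieldType) (L : lieAlgType F).
Implicit Types x y z : L.

HB.instance Definition _ x :=
  GRing.isLinear.Build F L L *:%R (lie x) (lie_linear_r x).

Lemma lieC x y : [lie x, y] = - [lie y, x].
Proof.
have lD u v w : [lie u + v, w] = [lie u, w] + [lie v, w].
  by have := lie_linear_l w 1 u v; rewrite /= !scale1r.
have := liexx (x + y); rewrite lD !raddfD /= !liexx add0r addr0.
by move/eqP; rewrite addr_eq0 => /eqP.
Qed.

Lemma lieDl x y z : [lie x + y, z] = [lie x, z] + [lie y, z].
Proof. by rewrite lieC raddfD /= opprD -!lieC. Qed.

Lemma lieNl x y : [lie - x, y] = - [lie x, y].
Proof. by rewrite lieC raddfN opprK lieC opprK. Qed.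

Lemma lieBl x y z : [lie x - y, z] = [lie x, z] - [lie y, z].
Proof. by rewrite lieDl lieNl. Qed.

Lemma lie_lie x y z :
  [lie [lie x, y], z] = [lie x, [lie y, z]] - [lie y, [lie x, z]].
Proof.
have /eqP := lie_jacobi x y z; rewrite addr_eq0 => /eqP.
by rewrite [[lie z, x]]lieC raddfN /= => ->; rewrite lieC.
Qed.

End LieTheory.

Definition abelian_lie (F : fieldType) (A : lieAlgType F) : Prop :=
  forall a b : A, [lie a, b] = 0.

(* The inverse map is a field, so that [theta^-1] needs no choice; it is
   determined by the map itself, see [lie_autP]. *)
Record lie_aut (F : fieldType) (L : lieAlgType F) := LieAut {
  aut_fun :> L -> L;
  aut_inv : L -> L;
  aut_linear : linear aut_fun;
  aut_lie : {morph aut_fun : x y / [lie x, y]};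
  aut_funK : cancel aut_fun aut_inv;
  aut_invK : cancel aut_inv aut_fun
}.

Section LieAutTheory.
Variables (F : fieldType) (L : lieAlgType F).

HB.instance Definition _ (g : lie_aut L) :=
  GRing.isLinear.Build F L L *:%R (aut_fun g) (aut_linear g).

Lemma lie_autP (g h : lie_aut L) : g =1 h -> g = h.
Proof.
case: g h => [g g' gl gb gK g'K] [h h' hl hb hK h'K] /= eq_gh.
have {}eq_gh : g = h by exact: funext.
subst h; have e' : g' = h' by apply: funext => x; rewrite -{1}(h'K x) gK.
subst h'; by rewrite (Prop_irrelevance gl hl) (Prop_irrelevance gb hb)
  (Prop_irrelevance gK hK) (Prop_irrelevance g'K h'K).
Qed.

Variable g : lie_aut L.

Lemma aut_inv_linear : linear (aut_inv g).
Proof.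
by move=> c x y; apply: (can_inj (aut_funK g)); rewrite linearP /= !aut_invK.
Qed.

Lemma aut_inv_lie : {morph aut_inv g : x y / [lie x, y]}.
Proof.
by move=> x y; apply: (can_inj (aut_funK g)); rewrite aut_lie !aut_invK.
Qed.

Definition lie_aut_inv : lie_aut L :=
  LieAut aut_inv_linear aut_inv_lie (aut_invK g) (aut_funK g).

End LieAutTheory.


Record lie_extension (F : fieldType) (A L B : lieAlgType F) := LieExtension {
  incl : {linear A -> L};
  proj : {linear L -> B};
  incl_lie : {morph incl : x y / [lie x, y] >-> [lie x, y]};
  proj_lie : {morph proj : x y / [lie x, y] >-> [lie x, y]};
  incl_inj : injective incl;
  exactness : forall x : L, proj x = 0 <-> exists a : A, incl a = x;
  proj_surj : forall b : B, exists x : L, proj x = b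
}.

Record lie_section (F : fieldType) (A L B : lieAlgType F)
    (E : lie_extension A L B) := LieSection {
  sec :> {linear B -> L};
  secK : cancel sec (proj E)
}.

Section Extension.
Variables (F : fieldType) (A L B : lieAlgType F) (E : lie_extension A L B).
Implicit Types (s : lie_section E) (x y : L) (a : A) (b : B).

Lemma proj_incl a : proj E (incl E a) = 0.
Proof. by apply/exactness; exists a. Qed.

Lemma exists_pull x : proj E x = 0 -> exists a, incl E a == x.
Proof. by move/exactness => [a <-]; exists a. Qed.

(* The element of [A] that an element of the ideal [incl A = ker proj]
   stands for. *)
Definition pull x (px0 : proj E x = 0) : A := xchoose (exists_pull px0).

Lemma pullK x (px0 : proj E x = 0) : incl E (pull px0) = x.
Proof. exact/eqP/(xchooseP (exists_pull px0)). Qed.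

Lemma proj_lie_incl x a : proj E [lie x, incl E a] = 0.
Proof. by rewrite proj_lie proj_incl raddf0. Qed.

Definition act s b a : A := pull (proj_lie_incl (s b) a).

Lemma incl_act s b a : incl E (act s b a) = [lie s b, incl E a].
Proof. exact: pullK. Qed.

Lemma act_linear s b : linear (act s b).
Proof.
by move=> c x y; apply: (@incl_inj _ _ _ _ E); rewrite !(linearP, incl_act).
Qed.

HB.instance Definition _ s b :=
  GRing.isLinear.Build F A A *:%R (act s b) (act_linear s b).

Definition alpha s b : {linear A -> A} := act s b.

Lemma proj_mu s b1 b2 : proj E ([lie s b1, s b2] - s [lie b1, b2]) = 0.
Proof. by rewrite raddfB /= proj_lie !secK subrr. Qed.

Definition mu s b1 b2 : A := pull (proj_mu s b1 b2).

Lemma incl_mu s b1 b2 :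
  incl E (mu s b1 b2) = [lie s b1, s b2] - s [lie b1, b2].
Proof. exact: pullK. Qed.

Lemma alpha_lie s b1 b2 a : abelian_lie A ->
  alpha s [lie b1, b2] a =
    alpha s b1 (alpha s b2 a) - alpha s b2 (alpha s b1 a).
Proof.
move=> abA; apply: (@incl_inj _ _ _ _ E).
rewrite raddfB /= !incl_act -lie_lie.
have -> : s [lie b1, b2] = [lie s b1, s b2] - incl E (mu s b1 b2).
  by rewrite incl_mu subKr.
by rewrite lieBl -incl_lie abA raddf0 subr0.
Qed.

Lemma alpha_indep s s' b a : abelian_lie A -> alpha s b a = alpha s' b a.
Proof.
move=> abA; apply: (@incl_inj _ _ _ _ E); rewrite /= !incl_act.
apply/eqP; rewrite -subr_eq0 -lieBl.
have p0 : proj E (s b - s' b) = 0 by rewrite raddfB /= !secK subrr.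
by rewrite -(pullK p0) -incl_lie abA raddf0.
Qed.

(* The group Aut_A(L), with [A] regarded as the ideal [incl A] of [L]. *)
Record ideal_aut := IdealAut {
  ideal_aut_val :> lie_aut L;
  ideal_aut_stable : ideal_aut_val @` range (incl E) = range (incl E)
}.

Lemma ideal_aut_inv_stable (g : ideal_aut) :
  (lie_aut_inv g) @` range (incl E) = range (incl E).
Proof.
have {1}<- := ideal_aut_stable g; apply/seteqP; split=> [x|x rx].
  by case=> _ [y ry <-] <-; rewrite /= aut_funK.
by exists (g x); [exists x | rewrite /= aut_funK].
Qed.

Definition ideal_aut_inv (g : ideal_aut) : ideal_aut :=
  IdealAut (ideal_aut_inv_stable g).

Lemma proj_ideal_aut (g : ideal_aut) a : proj E (g (incl E a)) = 0.
Proof.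
have : range (incl E) (g (incl E a)).
  by rewrite -(ideal_aut_stable g); exists (incl E a) => //; exists a.
by case=> a' _ <-; exact: proj_incl.
Qed.

Definition restrict (g : ideal_aut) a : A := pull (proj_ideal_aut g a).

Lemma incl_restrict g a : incl E (restrict g a) = g (incl E a).
Proof. exact: pullK. Qed.

Lemma restrict_linear g : linear (restrict g).
Proof.
by move=> c x y; apply: (@incl_inj _ _ _ _ E);
  rewrite !(linearP, incl_restrict).
Qed.

Lemma restrict_lie g : {morph restrict g : x y / [lie x, y]}.
Proof.
move=> x y; apply: (@incl_inj _ _ _ _ E).
by rewrite incl_restrict !incl_lie aut_lie !incl_restrict.
Qed.

Lemma restrictK g : cancel (restrict g) (restrict (ideal_aut_inv g)).
Proof.
by move=> a; apply: (@incl_inj _ _ _ _ E); rewrite !incl_restrict /= aut_funK.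
Qed.

Lemma restrictVK g : cancel (restrict (ideal_aut_inv g)) (restrict g).
Proof.
by move=> a; apply: (@incl_inj _ _ _ _ E); rewrite !incl_restrict /= aut_invK.
Qed.

Definition restrict_aut g : lie_aut A :=
  LieAut (restrict_linear g) (restrict_lie g) (@restrictK g) (@restrictVK g).

Definition induced s (g : ideal_aut) b : B := proj E (g (s b)).

Lemma induced_proj s g x : induced s g (proj E x) = proj E (g x).
Proof.
have p0 : proj E (s (proj E x) - x) = 0 by rewrite raddfB /= secK subrr.
apply/eqP; rewrite -subr_eq0 /induced -!raddfB /=.
by rewrite -(pullK p0) proj_ideal_aut.
Qed.

Lemma induced_linear s g : linear (induced s g).
Proof. by move=> c x y; rewrite /induced !linearP. Qed.

Lemma induced_lie s g : {morph induced s g : x y / [lie x, y]}.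
Proof.
move=> x y; rewrite -{1}(secK s x) -{1}(secK s y) -proj_lie induced_proj.
by rewrite aut_lie proj_lie.
Qed.

Lemma inducedK s g : cancel (induced s g) (induced s (ideal_aut_inv g)).
Proof. by move=> b; rewrite {2}/induced induced_proj /= aut_funK secK. Qed.

Lemma inducedVK s g : cancel (induced s (ideal_aut_inv g)) (induced s g).
Proof. by move=> b; rewrite {2}/induced induced_proj /= aut_invK secK. Qed.

Definition induced_aut s g : lie_aut B :=
  LieAut (induced_linear s g) (induced_lie s g)
    (@inducedK s g) (@inducedVK s g).

Definition tau s (g : ideal_aut) : lie_aut A * lie_aut B :=
  (restrict_aut g, induced_aut s g).

Definition inducible s (theta : lie_aut A) (phi : lie_aut B) : Prop :=
  exists g : ideal_aut, tau s g = (theta, phi).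

End Extension.

(* Main.v *)
Require Import Defs.
From HB Require Import structures.
From mathcomp Require Import all_boot all_algebra.
From mathcomp Require Import classical_sets.

Set Implicit Arguments.
Unset Strict Implicit.
Unset Printing Implicit Defensive.

Import GRing.Theory.
Local Open Scope ring_scope.

(* The section identifies [L] with [A x B] as a vector space, and in these
   coordinates the bracket is
   [(a1, b1), (a2, b2)] = (b1 a2 - b2 a1 + mu(b1, b2), [b1, b2]).
   A linear map that preserves [A] and induces [(theta, phi)] is of the form
   (a, b) |-> (theta a + lambda b, phi b). Comparing the [A]-coordinates of the
   images of brackets, condition (1) says that it respects brackets on [s B],
   and condition (2) that it respects those of [s B] with [A]. *)

Section Coordinates.
Variables (F : fieldType) (A L B : lieAlgType F) (E : lie_extension A L B).
Variable s : lie_section E.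
Implicit Types (x y : L) (a : A) (b : B).

Lemma proj_sub_sec x : proj E (x - s (proj E x)) = 0.
Proof. by rewrite raddfB /= secK subrr. Qed.

(** The [A]-coordinate of [x] relative to [s], paired with the [B]-coordinate [proj E x]. *)
Definition retract x : A := pull (proj_sub_sec x).

Lemma incl_retract x : incl E (retract x) = x - s (proj E x).
Proof. exact: pullK. Qed.

Lemma retract_linear : linear retract.
Proof.
move=> c x y; apply: (@incl_inj _ _ _ _ E).
rewrite linearP !incl_retract (linearP (proj E)) (linearP s) /=.
by rewrite scalerBr opprD addrACA.
Qed.

HB.instance Definition _ :=
  GRing.isLinear.Build F L A *:%R retract retract_linear.

Lemma retract_incl a : retract (incl E a) = a.
Proof.
by apply: (@incl_inj _ _ _ _ E); rewrite incl_retract proj_incl raddf0 subr0.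
Qed.

Lemma retract_sec b : retract (s b) = 0.
Proof.
by apply: (@incl_inj _ _ _ _ E); rewrite incl_retract secK subrr raddf0.
Qed.

Lemma decomp x : x = incl E (retract x) + s (proj E x).
Proof. by rewrite incl_retract subrK. Qed.

Lemma coord_inj x y : retract x = retract y -> proj E x = proj E y -> x = y.
Proof. by move=> rxy pxy; rewrite (decomp x) rxy pxy -decomp. Qed.

Hypothesis abA : abelian_lie A.

(** As [A] is abelian, the [A]-part of [x] brackets to zero with [incl E a], so only [s (proj E x)]
    acts. *)
Lemma lie_incl x a : [lie x, incl E a] = incl E (act s (proj E x) a).
Proof.
by rewrite {1}(decomp x) lieDl -incl_lie abA raddf0 add0r incl_act.
Qed.

Lemma retract_lie x y :
  retract [lie x, y] =
    act s (proj E x) (retract y) - act s (proj E y) (retract x)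
      + mu s (proj E x) (proj E y).
Proof.
apply: (@incl_inj _ _ _ _ E).
rewrite raddfD raddfB /= incl_mu incl_retract proj_lie.
(* Splitting [y] first gives the action on [retract y]; splitting [x] next gives the action on
   [retract x], with a sign from [lieC]. *)
rewrite {1}(decomp y) raddfD /= (lie_incl x) -!addrA; congr (_ + _).
rewrite {1}(decomp x) lieDl [[lie incl E _, _]]lieC lie_incl secK.
by rewrite -addrA.
Qed.

(* (a, b) |-> (f a + l b, g b) in the coordinates given by [s] *)
Definition glue (f : A -> A) (l : B -> A) (g : B -> B) x : L :=
  incl E (f (retract x) + l (proj E x)) + s (g (proj E x)).

Lemma proj_glue f l g x : proj E (glue f l g x) = g (proj E x).
Proof. by rewrite raddfD /= proj_incl secK add0r. Qed.

Lemma retract_glue f l g x :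
  retract (glue f l g x) = f (retract x) + l (proj E x).
Proof. by rewrite raddfD /= retract_incl retract_sec addr0. Qed.

Lemma glue_incl (f : A -> A) (l : {linear B -> A}) (g : {linear B -> B}) a :
  glue f l g (incl E a) = incl E (f a).
Proof. by rewrite /glue retract_incl proj_incl !raddf0 !addr0. Qed.

Lemma glue_linear (f : {linear A -> A}) (l : {linear B -> A})
  (g : {linear B -> B}) : linear (glue f l g).
Proof.
move=> c x y; apply: coord_inj; last by rewrite linearP /= !proj_glue !linearP.
rewrite linearP /= !retract_glue !linearP /=.
by rewrite scalerDr addrACA.
Qed.

End Coordinates.

Section GlueAut.
Variables (F : fieldType) (A L B : lieAlgType F) (E : lie_extension A L B).
Variables (abA : abelian_lie A) (s : lie_section E).
Variables (theta : lie_aut A) (phi : lie_aut B) (lambda : {linear B -> A}).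

Let glue_fun := glue s theta lambda phi.
(** Obtained by solving [a' = theta a + lambda b], [b' = phi b] for [a] and [b]. *)
Let glue_inv :=
  glue s (aut_inv theta)
    (fun b => - aut_inv theta (lambda (aut_inv phi b))) (aut_inv phi).

Lemma glueK : cancel glue_fun glue_inv.
Proof.
move=> x; apply: (coord_inj (s := s)); last by rewrite !proj_glue aut_funK.
rewrite !retract_glue proj_glue aut_funK.
(* Seen as an automorphism, the inverse carries the linear structure that [raddfD] needs. *)
by rewrite -[aut_inv theta]/(lie_aut_inv theta : A -> A) raddfD /= aut_funK addrK.
Qed.

Lemma glueVK : cancel glue_inv glue_fun.
Proof.
move=> x; apply: (coord_inj (s := s)); last by rewrite !proj_glue aut_invK.
by rewrite !retract_glue proj_glue raddfB /= !aut_invK subrK.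
Qed.

Hypothesis lambdaP : forall b1 b2 : B,
  theta (mu s b1 b2) - mu s (phi b1) (phi b2) =
  alpha s (phi b1) (lambda b2) - alpha s (phi b2) (lambda b1)
    - lambda [lie b1, b2].
Hypothesis alphaP :
  forall b : B, alpha s (phi b) =1 theta \o alpha s b \o lie_aut_inv theta.

Lemma glue_lie : {morph glue_fun : x y / [lie x, y]}.
Proof.
move=> x y; apply: (coord_inj (s := s)); last first.
  by rewrite proj_lie !proj_glue proj_lie aut_lie.
(* Condition (2) at [theta a], as an intertwining relation. *)
have act_theta b a : act s (phi b) (theta a) = theta (act s b a).
  by have /= -> := alphaP b (theta a); rewrite aut_funK.
rewrite retract_lie // !retract_glue !proj_glue retract_lie // proj_lie.
rewrite !raddfD raddfN /= !act_theta -!addrA; congr (_ + _).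
(* The terms in [retract x] and [retract y] now agree on both sides; the rest is condition (1). *)
have /eqP := lambdaP (proj E x) (proj E y).
rewrite subr_eq => /eqP /= ->.
by rewrite addrAC subrK [in RHS]addrCA -!addrA.
Qed.

Definition glue_aut : lie_aut L :=
  LieAut (glue_linear s theta lambda phi) glue_lie glueK glueVK.

Lemma glue_aut_stable :
  ((glue_aut : L -> L) @` range (incl E) = range (incl E))%classic.
Proof.
apply/seteqP; split=> [_ [_ [a _ <-] <-]|_ [a _ <-]] /=.
  by exists (theta a); rewrite // /glue_fun glue_incl.
exists (incl E (aut_inv theta a)); first by exists (aut_inv theta a).
by rewrite /glue_fun glue_incl aut_invK.
Qed.

Lemma glue_inducible : inducible s theta phi.
Proof.
exists (IdealAut glue_aut_stable); congr pair; apply: lie_autP => z.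
  apply: (@incl_inj _ _ _ _ E).
  by rewrite /= incl_restrict /= /glue_fun glue_incl.
by rewrite /= /induced /= proj_glue secK.
Qed.

End GlueAut.

Section Inducible.
Variables (F : fieldType) (A L B : lieAlgType F) (E : lie_extension A L B).
Variables (abA : abelian_lie A) (s : lie_section E) (g : ideal_aut E).

(** Measures how far [g] is from preserving the section: [g (s b)] is [lambda b] plus [s] of the
    induced image of [b]. *)
Let lambda : {linear B -> A} := retract s \o (g \o s).

(** The [A]-coordinate of [g [lie s b1, s b2]] is computed twice: by moving [g] inside the bracket,
    and by writing the bracket through [mu]. *)
Lemma restrict_mu b1 b2 :
  restrict g (mu s b1 b2) - mu s (induced s g b1) (induced s g b2) =
  act s (induced s g b1) (lambda b2) - act s (induced s g b2) (lambda b1)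
    - lambda [lie b1, b2].
Proof.
have := retract_lie s abA (g (s b1)) (g (s b2)).
have sK : [lie s b1, s b2] = incl E (mu s b1 b2) + s [lie b1, b2].
  by rewrite incl_mu subrK.
rewrite -aut_lie sK raddfD /= -incl_restrict raddfD /= retract_incl => /eqP.
rewrite -subr_eq => /eqP <-.
by rewrite addrAC addrK.
Qed.

Lemma restrict_act b a :
  restrict g (act s b a) = act s (induced s g b) (restrict g a).
Proof.
apply: (@incl_inj _ _ _ _ E).
by rewrite incl_restrict incl_act aut_lie -incl_restrict (lie_incl s abA).
Qed.

End Inducible.

Theorem theorem1p1 (F : fieldType) (A L B : lieAlgType F)
    (E : lie_extension A L B) (abA : abelian_lie A) (s : lie_section E)
    (theta : lie_aut A) (phi : lie_aut B) :
  inducible s theta phi <->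
  (exists lambda : {linear B -> A}, forall b1 b2 : B,
      theta (mu s b1 b2) - mu s (phi b1) (phi b2) =
      alpha s (phi b1) (lambda b2) - alpha s (phi b2) (lambda b1)
        - lambda [lie b1, b2])
  /\ (forall b : B, alpha s (phi b) =1 theta \o alpha s b \o lie_aut_inv theta).
Proof.
split=> [[g [<- <-]]|[[lambda lambdaP] alphaP]]; last first.
  exact: (glue_inducible abA lambdaP alphaP).
split; first by eexists; exact: restrict_mu.
(* Equivariance of the restriction, applied to the preimage of [a], is the conjugation formula. *)
by move=> b a /=; rewrite restrict_act // restrictVK.
Qed.
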